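(* There exists $n_0\in\mathbb{N}$ such that the following holds. Let $S\subset\mathbb{R}^3$ be a finite set with $|S|\geq n_0$ and let $r\colon S\to(0,\infty)$ be such that $e_r(S)=f_3(|S|)$. Then there exists $T\subseteq S$ with $|T|\leq 2$ such that $S\setminus T$ (with the restriction of $r$ to $S\setminus T$) is a suspension with some circle $\mathcal{C}$ and its symmetry axis $\mathcal{L}$.
   Context: Let $d(x,y)$ denote Euclidean distance in $\mathbb{R}^3$, and $d(x,A)$ the distance from the point $x$ to the set $A$. For a finite set $S\subset\mathbb{R}^3$ and a function $r\colon S\to(0,\infty)$, let $\vec{E}_r(S)=\{(x,y) : x,y\in S,\ d(x,y)=r(x)\}$ (a set of ordered pairs) and $e_r(S)=|\vec{E}_r(S)|$. Define \[ f_3(n)=\max\{e_r(S) : S\subset\mathbb{R}^3,\ |S|=n,\ r\colon S\to(0,\infty)\}.\] The axis of symmetry of a circle $\mathcal{C}$ in $\mathbb{R}^3$ is the line through the centre of $\mathcal{C}$ perpendicular to the plane of $\mathcal{C}$. A finite set $S\subset\mathbb{R}^3$ together with a function $r\colon S\to(0,\infty)$ is called a suspension with circle $\mathcal{C}$ and symmetry axis $\mathcal{L}$ if $\mathcal{C}$ is a circle (of positive radius) in $\mathbb{R}^3$ with axis of symmetry $\mathcal{L}$, $S\subset\mathcal{C}\cup\mathcal{L}$, and $r(x)=d(x,\mathcal{C})$ for all $x\in S\cap\mathcal{L}$. *)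

(* Defs.v *)
From HB Require Import structures.
From mathcomp Require Import all_boot all_order all_algebra finmap.
From mathcomp Require Import boolp classical_sets functions reals.

Set Implicit Arguments.
Unset Strict Implicit.
Unset Printing Implicit Defensive.

Import Order.TTheory GRing.Theory Num.Theory.
Local Open Scope ring_scope.
Local Open Scope classical_set_scope.

(* The real line is an arbitrary [R : realType] and R^3 is ['rV[R]_3]. *)
Definition dot (R : realType) (u v : 'rV[R]_3) : R :=
  \sum_(i < 3) u ord0 i * v ord0 i.

(* The norm that MathComp-Analysis puts on row vectors is the sup norm, so the
   Euclidean distance is defined here. *)
Definition eucl_dist (R : realType) (x y : 'rV[R]_3) : R :=
  Num.sqrt (dot (x - y) (x - y)).

Definition eucl_dist_set (R : realType) (x : 'rV[R]_3) (A : set 'rV[R]_3) : R :=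
  inf [set eucl_dist x y | y in A].

(* A radius function on S is a total function on R^3 that is positive on S;
   nothing below depends on its values outside S. *)
Definition radius_fun (R : realType) (S : {fset 'rV[R]_3})
    (r : 'rV[R]_3 -> R) : Prop :=
  forall x, x \in S -> 0 < r x.

Definition edges (R : realType) (r : 'rV[R]_3 -> R) (S : {fset 'rV[R]_3}) :
    {fset 'rV[R]_3 * 'rV[R]_3} :=
  [fset p in (S `*` S)%fset | eucl_dist p.1 p.2 == r p.1]%fset.

Definition nb_edges (R : realType) (r : 'rV[R]_3 -> R)
    (S : {fset 'rV[R]_3}) : nat := #|` edges r S|.

Definition f3_value (R : realType) (n k : nat) : Prop :=
  exists (S : {fset 'rV[R]_3}) (r : 'rV[R]_3 -> R),
    [/\ #|` S| = n, radius_fun S r & nb_edges r S = k].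

(* The a priori bound k <= n ^ 2 only makes the maximum range over a finite
   type; [f3_attained] and [f3_ge] show that this is the maximum of all
   values. *)
Definition f3 (R : realType) (n : nat) : nat :=
  \max_(k < (n ^ 2).+1 | `[< f3_value R n k >]) k.

Definition circle (R : realType) (c u : 'rV[R]_3) (rho : R) : set 'rV[R]_3 :=
  [set x | dot (x - c) u = 0 /\ eucl_dist x c = rho].

Definition line (R : realType) (c u : 'rV[R]_3) : set 'rV[R]_3 :=
  [set x | exists t : R, x = c + t *: u].

Definition circle_with_axis (R : realType) (C L : set 'rV[R]_3) : Prop :=
  exists (c u : 'rV[R]_3) (rho : R),
    [/\ u != 0, 0 < rho, C = circle c u rho & L = line c u].

Definition suspension (R : realType) (S : {fset 'rV[R]_3})
    (r : 'rV[R]_3 -> R) (C L : set 'rV[R]_3) : Prop :=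
  [/\ circle_with_axis C L,
      [set` S] `<=` C `|` L &
      forall x, x \in S -> L x -> r x = eucl_dist_set x C].

Lemma f3_value_le (R : realType) n k : f3_value R n k -> (k <= n ^ 2)%N.
Proof.
move=> [S [r [<- _ <-]]]; rewrite /nb_edges -mulnn.
rewrite -(size_allpairs (fun x y => (x, y))); apply: uniq_leq_size.
  exact: fset_uniq.
move=> [x y]; rewrite /edges !inE /= => /andP[/andP[xS yS] _].
by apply/allpairsP; exists (x, y).
Qed.

Lemma f3_value_ex (R : realType) n : exists k, f3_value R n k.
Proof.
pose p (i : nat) := (const_mx i%:R : 'rV[R]_3).
have pI : injective p.
  by move=> i j /matrixP/(_ ord0 ord0); rewrite !mxE => /eqP; rewrite eqr_nat => /eqP.
pose S : {fset 'rV[R]_3} := [fset x in map p (iota 0 n)]%fset.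
exists (nb_edges (fun=> 1) S), S, (fun=> 1); split=> //.
by rewrite card_fseq undup_id ?size_map ?size_iota // map_inj_uniq ?iota_uniq.
Qed.

Lemma f3_attained (R : realType) n : f3_value R n (f3 R n).
Proof.
have [k Pk] := f3_value_ex R n.
have kn : (k < (n ^ 2).+1)%N by rewrite ltnS (f3_value_le Pk).
pose A := [pred i : 'I_(n ^ 2).+1 | `[< f3_value R n i >]].
have A_gt0 : (0 < #|A|)%N by apply/card_gt0P; exists (Ordinal kn); apply/asboolP.
have [i /asboolP Pi eq_i] := eq_bigmax_cond (fun i : 'I_(n ^ 2).+1 => i : nat) A_gt0.
suff -> : f3 R n = i by [].
by rewrite -eq_i; apply: eq_bigl.
Qed.

Lemma f3_ge (R : realType) n k : f3_value R n k -> (k <= f3 R n)%N.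
Proof.
move=> Pk; have kn : (k < (n ^ 2).+1)%N by rewrite ltnS (f3_value_le Pk).
by apply: (@leq_bigmax_cond _ _ (fun i : 'I_(n ^ 2).+1 => i : nat) (Ordinal kn)); apply/asboolP.
Qed.

(* Main.v *)
(* Join x to y when d(x, y) = r(x).  In this digraph two centres x1, x2 have
   their common out-neighbours on a circle around the line x1 x2, and a third
   centre sharing three of them lies on that line and is joined to all of them;
   moreover no x is joined to three points that are all joined to the same three
   points, since a sphere meets a line at most twice.

   Call B = N(x1) & N(x2) rich if |B| >= n/q, and let A be the set of points joined
   to all of B.  Distinct rich sets and their sets of centres meet in at most two
   points, so by Cauchy-Schwarz the numbers |A| + |B| add up to n + O(1), and the
   edges not going from some A to its B number O(n^2 / sqrt q).  A suspension with
   half of its points on the circle has about n^2/4 edges, so in a maximal S one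
   pair (A, B) contains all but few points and is nearly balanced.

   Let D be the set of the remaining points.  Replacing x in D by a new point of the
   axis creates |B| edges, so x has degree at least |B|; but x has at most
   5 + 2|D| edges other than those coming from B.  Hence three points of D would
   have three common in-neighbours in B, which is impossible. *)

Require Import Defs.
From mathcomp Require Import all_boot all_order all_algebra finmap.
From mathcomp Require Import boolp classical_sets functions reals.
(* Loaded again so that the names shared with [classical_sets] refer to finite sets. *)
From mathcomp Require Import fintype finset finmap.
From mathcomp Require Import zify ring lra.

Set Implicit Arguments.
Unset Strict Implicit.
Unset Printing Implicit Defensive.
Import Order.TTheory GRing.Theory Num.Theory.

(** * Numerical estimates for the heaviest rich pair *)

Section DensePart.
Local Open Scope ring_scope.

(* The bounds give in turn s <= 1.005 n, rho <= n^2 / 200, a + b >= 0.974 n and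
   a - b <= 0.16 n. *)
Lemma dense_part_real (F : realFieldType) (q n e rho s k ab a b : F) :
    400 * 200 <= q -> 1608 * q ^+ 2 <= n ->
    0 <= rho -> 0 <= s -> 0 <= k -> 0 <= a -> 0 <= b ->
    q * rho ^+ 2 <= n ^+ 3 * (q + n) ->
    s ^+ 2 <= n * (s + 2 * (2 * k) ^+ 2) ->
    k * n <= q * s -> e <= rho + ab ->
    4 * ab + (a ^+ 2 + b ^+ 2) <= (a + b) * s + 2 * (a * b) ->
    n ^+ 2 <= 4 * e + 1 -> a + b <= n ->
  6 * n + 18 <= 6 * (a + b) + b.
Proof.
move=> q_big n_big rho0 s0 k0 a0 b0 hrho hs hk he hab hn hM.
have qn : 1000 * q <= n by nra.
have n0 : 0 < n by lra.
have s_le : 200 * s <= 201 * n.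
  case: (ltrgtP s 0) => [|s_gt0|->]; [by lra| |by lra].
  have kn2 : (k * n) ^+ 2 <= (q * s) ^+ 2 by rewrite ler_sqr ?nnegrE; nra.
  have h1 : n * s ^+ 2 <= n ^+ 2 * s + 8 * (q * s) ^+ 2.
    apply: (@le_trans _ _ (n * (n * (s + 2 * (2 * k) ^+ 2)))).
      by rewrite ler_pM2l.
    by rewrite (_ : _ * (_ * _) = n ^+ 2 * s + 8 * (k * n) ^+ 2) ?lerD2l ?ler_pM2l //; ring.
  (* The ratio n / (n - 8 q^2) is at most 201/200 exactly when n >= 8 * 201 * q^2, the source of
     1608. *)
  have h2 : (n - 8 * q ^+ 2) * s <= n ^+ 2 by rewrite -(ler_pM2r s_gt0); lra.
  have h3 : 200 * n * s <= 201 * n ^+ 2 by nra.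
  by rewrite -(ler_pM2l n0); lra.
(* As q <= n, rho^2 <= 2 n^4 / q, and 2 / q <= 1 / 200^2 means q >= 400 * 200. *)
have rho_le : 200 * rho <= n ^+ 2.
  rewrite leNgt; apply/negP => lt_rho.
  have : (n ^+ 2) ^+ 2 < (200 * rho) ^+ 2.
    by rewrite ltr_sqr ?nnegrE ?sqr_ge0 //; lra.
  have n3 : 0 < n ^+ 3 by apply: exprn_gt0.
  have : n ^+ 3 * (q + n) <= n ^+ 3 * (2 * n) by rewrite ler_pM2l //; lra.
  have : 400 * 200 * rho ^+ 2 <= q * rho ^+ 2 by rewrite ler_wpM2r ?sqr_ge0.
  rewrite [(n ^+ 2) ^+ 2](_ : _ = n ^+ 3 * n); last by ring.
  by rewrite exprMn; lra.
have hMs : (a + b) * s <= (a + b) * (201 / 200 * n) by rewrite ler_wpM2l; lra.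
have hMn : (a + b) * n <= n * n by rewrite ler_pM2r.
have n_ge : 100 * 100 <= n by lra.
have nn_ge : 100 * 100 * n <= n * n by rewrite ler_pM2r.
(* [hab] rearranges to 4 [ab] + (a - b)^2 <= (a + b) s. With 4 [ab] >= n^2 - 4 rho - 1 this bounds a
   + b below and a - b above. *)
have M_ge : 974 * n <= 1000 * (a + b).
  rewrite -(ler_pM2l n0).
  have : 0 <= (a - b) ^+ 2 by apply: sqr_ge0.
  by lra.
have d_le : (100 * (a - b)) ^+ 2 <= (16 * n) ^+ 2 by lra.
have : 100 * (a - b) <= 16 * n.
  rewrite leNgt; apply/negP => lt_d.
  by move: d_le; rewrite leNgt ltr_sqr ?nnegrE ?lt_d //; lra.
by lra.
Qed.

(** Here [s] sums the weights |A| + |B| of the [k] rich pairs, [ab] sums the products |A| |B|, and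
    [rho] counts the edges outside them; [a] and [b] belong to the heaviest pair. The conclusion
    means b >= 6 d + 18, where d = n - a - b points lie outside that pair. *)
Lemma dense_part (q n e rho s k ab a b : nat) :
  (400 * 200 <= q -> 1608 * q ^ 2 <= n ->
    q * rho ^ 2 <= n ^ 3 * (q + n) ->
    s ^ 2 <= n * (s + 2 * (2 * k) ^ 2) ->
    k * n <= q * s -> e <= rho + ab ->
    4 * ab + (a ^ 2 + b ^ 2) <= (a + b) * s + 2 * (a * b) ->
    n ^ 2 <= 4 * e + 1 -> a + b <= n ->
  6 * n + 18 <= 6 * (a + b) + b)%N.
Proof.
move=> q_big n_big hrho hs hk he hab hn hM.
have toR m1 m2 : (m1 <= m2)%N -> m1%:R <= m2%:R :> rat by rewrite ler_nat.
rewrite -(ler_nat rat).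
move: (toR _ _ q_big) (toR _ _ n_big) (toR _ _ hrho) (toR _ _ hs) (toR _ _ hk).
move: (toR _ _ he) (toR _ _ hab) (toR _ _ hn) (toR _ _ hM).
rewrite !(natrD, natrM, natrX) => {}he {}hab {}hn {}hM {}q_big {}n_big {}hrho {}hs {}hk.
exact: (dense_part_real q_big n_big (ler0n _ _) (ler0n _ _) (ler0n _ _)
  (ler0n _ _) (ler0n _ _) hrho hs hk he hab hn hM).
Qed.
End DensePart.

(** * Cauchy-Schwarz for families of finite sets *)

Section Multiplicity.
Variables (T I : finType) (P : pred I) (F : I -> {set T}).

Let m v := \sum_(i | P i) (v \in F i).

Lemma sum_card_mult : \sum_v m v = \sum_(i | P i) #|F i|.
Proof.
rewrite exchange_big; apply: eq_bigr => i _.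
by rewrite -sum1_card [RHS]big_mkcond; apply: eq_bigr => v _; case: (v \in F i).
Qed.

Lemma sum_sqr_mult :
  \sum_v m v ^ 2 = \sum_(i | P i) \sum_(j | P j) #|F i :&: F j|.
Proof.
have -> : \sum_v m v ^ 2 =
  \sum_v \sum_(i | P i) \sum_(j | P j) ((v \in F i) * (v \in F j)).
  apply: eq_bigr => v _; rewrite -mulnn /m big_distrl /=; apply: eq_bigr => i _.
  by rewrite big_distrr.
rewrite exchange_big; apply: eq_bigr => i _.
rewrite exchange_big; apply: eq_bigr => j _.
rewrite -sum1_card [RHS]big_mkcond; apply: eq_bigr => v _.
by rewrite inE; do 2 case: (v \in _).
Qed.

(** Cauchy-Schwarz for [m]: sum 2 m(v) m(w) <= m(v)^2 + m(w)^2 over all v, w. *)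
Lemma sqr_sum_card :
  (\sum_(i | P i) #|F i|) ^ 2 <=
  #|T| * \sum_(i | P i) \sum_(j | P j) #|F i :&: F j|.
Proof.
rewrite -sum_card_mult -sum_sqr_mult -(leq_pmul2l (isT : 0 < 2)).
rewrite -mulnn big_distrl /= big_distrr /=.
have -> : 2 * (#|T| * \sum_v m v ^ 2) = \sum_v \sum_w (m v ^ 2 + m w ^ 2).
  have -> : \sum_v \sum_w (m v ^ 2 + m w ^ 2) =
            \sum_v (#|T| * m v ^ 2 + \sum_w m w ^ 2).
    by apply: eq_bigr => v _; rewrite big_split /= sum_nat_const.
  by rewrite big_split /= -big_distrr /= sum_nat_const mul2n addnn.
apply: leq_sum => v _; rewrite big_distrr /= big_distrr /=.
by apply: leq_sum => w _; exact: nat_Cauchy.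
Qed.

(** The diagonal terms give |F i|, the others at most [c] each. *)
Lemma sqr_sum_card_le c :
    (forall i j, P i -> P j -> i != j -> #|F i :&: F j| <= c) ->
  (\sum_(i | P i) #|F i|) ^ 2 <=
  #|T| * (\sum_(i | P i) #|F i| + c * #|P| ^ 2).
Proof.
move=> Fc; apply: leq_trans sqr_sum_card _; rewrite leq_mul2l; apply/orP; right.
have -> : c * #|P| ^ 2 = \sum_(i | P i) c * #|P|.
  by rewrite sum_nat_const mulnCA mulnn.
rewrite -big_split /=; apply: leq_sum => i Pi.
rewrite (bigD1 i) //= setIid leq_add2l.
apply: (@leq_trans (\sum_(j | P j && (j != i)) c)).
  by apply: leq_sum => j /andP[Pj ji]; rewrite Fc // eq_sym.
rewrite sum_nat_const mulnC leq_mul2l subset_leq_card ?orbT //.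
by apply/subsetP => j /andP[].
Qed.

End Multiplicity.

(** * Digraphs with the incidence properties of spheres and lines *)

Section Digraph.
Variables (T : finType) (E : rel T).

Definition out x := [set y | E x y].
Definition inn y := [set x | E x y].
Definition centres (B : {set T}) := [set x | B \subset out x].

(** Apart from [ext] in [suspension_structure], the geometry enters the counting only through these
    three properties. *)
Hypothesis irrE : forall x, ~~ E x x.
Hypothesis codegE : forall x1 x2 x3, x1 != x2 ->
  2 < #|out x1 :&: out x2 :&: out x3| -> out x1 :&: out x2 \subset out x3.
Hypothesis no_chain : forall x (Y Z : {set T}),
  Y \subset out x -> Y \subset centres Z -> 2 < #|Y| -> #|Z| <= 2.

Lemma codeg_centres x1 x2 (B := out x1 :&: out x2) x3 :
  x1 != x2 -> x3 \notin centres B -> #|out x3 :&: B| <= 2.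
Proof.
move=> x12; apply: contraNT; rewrite -ltnNge setIC => /(codegE x12).
by rewrite inE.
Qed.

Lemma centres_disjoint (B : {set T}) : centres B :&: B = set0.
Proof.
apply/setP => x; rewrite !inE; apply/negP => /andP[/subsetP h xB].
by have := h x xB; rewrite inE; apply/negP.
Qed.

(** Both [x3] and [x4] share the points of [B] with [x1] and [x2], so [codegE] gives one inclusion;
    the other is symmetric. *)
Lemma codeg_unique x1 x2 x3 x4 (B : {set T}) :
    x1 != x2 -> x3 != x4 -> B \subset out x1 :&: out x2 ->
    B \subset out x3 :&: out x4 -> 2 < #|B| ->
  out x1 :&: out x2 = out x3 :&: out x4.
Proof.
move=> x12 x34 B12 B34 B2.
have half y1 y2 y3 y4 : y1 != y2 -> B \subset out y1 :&: out y2 ->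
    B \subset out y3 :&: out y4 -> out y1 :&: out y2 \subset out y3 :&: out y4.
  move=> y12 s12; rewrite !subsetI => /andP[s3 s4].
  by rewrite !codegE // (leq_trans B2) // subset_leq_card // subsetI s12.
by apply/eqP; rewrite eqEsubset !half.
Qed.

(** * Rich sets and their centres *)

Section Rich.
Variable q : nat.

(** A property of the set, not of the pair, so that a set arising from many pairs is counted
    once. *)
Definition codeg_set (B : {set T}) :=
  [exists x1, exists x2, (x1 != x2) && (B == out x1 :&: out x2)].
Definition rich (B : {set T}) := codeg_set B && (#|T| <= q * #|B|).

Hypothesis q3 : 2 * q < #|T|.

Lemma rich_gt2 B : rich B -> 2 < #|B|.
Proof. by move=> /andP[_ h]; rewrite -(ltn_pmul2l (m := q)); nia. Qed.

(** Two common centres x, y would force both sets to equal [out x :&: out y]. *)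
Lemma rich_centresI B B' : rich B -> rich B' -> B != B' ->
  #|centres B :&: centres B'| <= 1.
Proof.
move=> rB rB'; apply: contraNT; rewrite -ltnNge => /card_gt1P[x [y []]].
rewrite !inE => /andP[xB xB'] /andP[yB yB'] xy.
have eqB D : rich D -> D \subset out x -> D \subset out y -> D = out x :&: out y.
  move=> rD Dx Dy; have /andP[/existsP[a /existsP[b /andP[ab /eqP eD]]] _] := rD.
  by rewrite eD; apply: codeg_unique (rich_gt2 rD) => //; rewrite ?eD // -eD subsetI Dx.
by rewrite (eqB B) // [X in _ == X](eqB B').
Qed.

Lemma rich_capI B B' : rich B -> rich B' -> B != B' -> #|B :&: B'| <= 2.
Proof.
move=> /andP[/existsP[a /existsP[b /andP[ab /eqP eB]]] _].
move=> /andP[/existsP[c /existsP[d /andP[cd /eqP eB']]] _].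
apply: contraNT; rewrite -ltnNge => B2; apply/eqP.
by rewrite eB eB'; apply: codeg_unique B2; rewrite ?eB ?eB' ?subsetIl ?subsetIr.
Qed.

(** [B'] lies in some [out a], so three centres of [B] in [B'] would be joined from [a] and to all
    of [B], against [no_chain]. *)
Lemma rich_centres_cap B B' : rich B -> rich B' -> #|centres B :&: B'| <= 2.
Proof.
move=> rB /andP[/existsP[a /existsP[b /andP[ab /eqP ->]]] _].
rewrite leqNgt; apply/negP => h; have := rich_gt2 rB; rewrite ltnNge.
by rewrite (@no_chain a _ B _ _ h) ?subsetIl // setICA subsetIl.
Qed.

Definition weight (B : {set T}) := #|centres B| + #|B|.

(** Cauchy-Schwarz for the 2k sets [B] and [centres B], any two of which share at most two points;
    the boolean index selects between the two kinds. *)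
Lemma sum_weight_sqr (s := \sum_(B | rich B) weight B) (k := #|rich|) :
  s ^ 2 <= #|T| * (s + 2 * (2 * k) ^ 2).
Proof.
pose P (i : {set T} * bool) := rich i.1 && true.
pose F (i : {set T} * bool) := if i.2 then centres i.1 else i.1.
have Ps : \sum_(i | P i) #|F i| = s.
  rewrite -(pair_big rich predT (fun B b => #|F (B, b)|)) /=.
  by apply: eq_bigr => B _; rewrite big_bool.
have Pk : #|P| = 2 * k.
  rewrite -sum1_card -(pair_big rich predT (fun _ _ => 1)) /=.
  under eq_bigr do rewrite big_bool /=.
  by rewrite sum_nat_const mulnC.
rewrite -Ps -Pk; apply: sqr_sum_card_le => -[B b] [B' b'].
rewrite /P /F !andbT /= => rB rB' ne.
case: b b' ne => -[] ne.
- apply: leq_trans (rich_centresI rB rB' _) _ => //.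
  by apply: contraNneq ne => ->.
- exact: rich_centres_cap.
- by rewrite setIC rich_centres_cap.
- apply: rich_capI => //.
  by apply: contraNneq ne => ->.
Qed.

Lemma card_rich_le : #|rich| * #|T| <= q * \sum_(B | rich B) weight B.
Proof.
rewrite big_distrr /= -sum_nat_const; apply: leq_sum => B /andP[_ h].
by apply: leq_trans h _; rewrite leq_mul2l leq_addl orbT.
Qed.

(* The edges out of [x] not explained by a rich set that [x] is a centre of. *)
Definition rest x := out x :\: \bigcup_(B | rich B && (x \in centres B)) B.

(** A larger overlap would make [out x :&: out y] rich with centres x and y, hence removed from both
    rests. *)
Lemma rest_cap x y : x != y -> q * #|rest x :&: rest y| <= #|T|.
Proof.
move=> xy; rewrite leqNgt; apply/negP => h.
have sub : rest x :&: rest y \subset out x :&: out y.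
  by apply: setISS; apply: subsetDl.
have rB : rich (out x :&: out y).
  apply/andP; split.
    by apply/existsP; exists x; apply/existsP; exists y; rewrite xy eqxx.
  by apply: leq_trans (ltnW h) _; rewrite leq_mul2l subset_leq_card ?orbT.
have : rest x :&: rest y = set0.
  apply/eqP; rewrite -subset0; apply/subsetP => z zr.
  have zB := subsetP sub _ zr; move: zr; rewrite !inE => /andP[/andP[/negP zn _] _].
  exfalso; apply: zn; apply/bigcupP; exists (out x :&: out y) => //.
  by rewrite rB inE subsetIl.
by move=> e; rewrite e cards0 muln0 in h.
Qed.

(** Cauchy-Schwarz with overlaps at most n/q, using the crude bound s <= n^2 in the linear term. *)
Lemma sum_rest_sqr (s := \sum_x #|rest x|) :
  q * s ^ 2 <= #|T| ^ 3 * (q + #|T|).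
Proof.
case: (posnP q) => [->|q0]; first by rewrite mul0n.
have h x y : x != y -> #|rest x :&: rest y| <= #|T| %/ q.
  by move=> xy; rewrite leq_divRL // mulnC rest_cap.
have := @sqr_sum_card_le _ T predT rest (#|T| %/ q) (fun x y _ _ => @h x y).
rewrite -/s => hs.
have s_le : s <= #|T| * #|T|.
  by rewrite /s -sum_nat_const; apply: leq_sum => x _; apply: max_card.
have := leq_divM #|T| q.
move: hs; have -> : #|predT : pred T| = #|T| by apply: eq_card.
set d := _ %/ _; set n := #|T| in s_le * => hs hd.
apply: (@leq_trans (q * (n * (n * n + d * n ^ 2)))).
  by rewrite leq_mul2l (leq_trans hs) ?orbT // leq_mul2l leq_add2r s_le orbT.
have -> : q * (n * (n * n + d * n ^ 2)) = n ^ 3 * (q + d * q) by lia.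
by rewrite leq_mul2l leq_add2l hd orbT.
Qed.

Lemma sum_out_le :
  \sum_x #|out x| <=
  \sum_x #|rest x| + \sum_(B | rich B) #|centres B| * #|B|.
Proof.
have -> : \sum_(B | rich B) #|centres B| * #|B| =
    \sum_x \sum_(B | rich B && (x \in centres B)) #|B|.
  rewrite [RHS](exchange_big_dep rich) /=; last by move=> x B _ /andP[].
  apply: eq_bigr => B rB; rewrite -sum_nat_const.
  by apply: eq_bigl => x; rewrite rB.
rewrite -big_split /=; apply: leq_sum => x _.
set U := \bigcup_(B | rich B && (x \in centres B)) B.
rewrite -(cardsID U (out x)) addnC leq_add2l.
apply: leq_trans (subset_leq_card (subsetIr _ _)) _.
rewrite /U; elim/big_rec2: _ => [|B k V _ ih]; first by rewrite cards0.
by apply: leq_trans (leq_card_setU _ _) _; rewrite leq_add2l.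
Qed.


(** The rich set of largest weight works. *)
Lemma rich_dense :
    400 * 200 <= q -> 1608 * q ^ 2 <= #|T| ->
    #|T| ^ 2 <= 4 * (\sum_x #|out x|) + 1 ->
  exists2 B, rich B & 6 * #|T| + 18 <= 6 * weight B + #|B|.
Proof.
move=> q_big n_big he.
have hrho := sum_rest_sqr; have hs := sum_weight_sqr; have hk := card_rich_le.
have hout := sum_out_le.
(* With no rich set, all sums over rich sets vanish and a = b = 0 would give 6 n + 18 <= 0. *)
have [B0 rB0|no_rich] := pickP rich; last first.
  have := dense_part (a := 0) (b := 0) q_big n_big hrho hs hk hout _ he.
  by rewrite !(big_pred0 _ _ _ _ no_rich) => /(_ isT isT); rewrite addnC.
have [B rB max_B] := arg_maxnP weight rB0.
exists B => //; apply: dense_part q_big n_big hrho hs hk hout _ he _; last first.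
  by rewrite -cardsUI centres_disjoint cards0 addn0 max_card.
rewrite (bigD1 B) //= [X in _ <= _ * X + _](bigD1 B) //= !mulnDr.
(* By AM-GM each product is at most a quarter of a squared weight, and one factor is at most the
   largest weight. *)
have : 4 * \sum_(C | rich C && (C != B)) #|centres C| * #|C| <=
       (#|centres B| + #|B|) * \sum_(C | rich C && (C != B)) weight C.
  rewrite !big_distrr /=; apply: leq_sum => C /andP[rC _].
  apply: (@leq_trans (weight C * weight C)).
    by rewrite mulnn; exact: (nat_AGM2 #|centres C| #|C|).
  by rewrite leq_mul2r; apply/orP; right; exact: max_B.
move: (\sum_(C | _) _) (\sum_(C | _) _) => S1 S2.
rewrite /weight; move: #|centres B| #|B| => a b; rewrite -!mulnn => h.
by nia.
Qed.

End Rich.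

(** [ext] is what maximality provides: a vertex outside [B] could be exchanged for a new centre of
    [B]. *)
Lemma suspension_structure :
    (forall x1 x2 x, x1 != x2 -> 2 < #|out x1 :&: out x2| ->
       x \notin out x1 :&: out x2 ->
     #|out x1 :&: out x2| <= #|out x| + #|inn x|) ->
    forall q, 400 * 200 <= q -> 1608 * q ^ 2 <= #|T| ->
    #|T| ^ 2 <= 4 * (\sum_x #|out x|) + 1 ->
  exists x1 x2 (B := out x1 :&: out x2),
    [/\ x1 != x2, 2 < #|B| & #|~: (centres B :|: B)| <= 2].
Proof.
move=> ext q q_big n_big he.
have q3 : 2 * q < #|T| by nia.
have [B rB B_big] := rich_dense q3 q_big n_big he.
have B2 := rich_gt2 q3 rB.
have /andP[/existsP[x1 /existsP[x2 /andP[x12 /eqP eB]]] _] := rB.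
exists x1, x2; rewrite /= -eB; split=> //.
set D := ~: _; rewrite leqNgt; apply/negP => /card_gt2P[a [b [c [[aD bD cD] [ab bc ca]]]]].
have D_card : #|D| + weight B = #|T|.
  by rewrite /weight -cardsUI centres_disjoint cards0 addn0 addnC cardsC.
have inn_ge x : x \in D -> #|B| <= #|B :&: inn x| + (5 + 2 * #|D|).
  rewrite in_setC in_setU negb_or => /andP[xA xB].
  have : #|B| <= #|out x| + #|inn x| by rewrite eB; apply: ext; rewrite -?eB.
  (* At most two edges go to centres by [no_chain], and two into [B] because x is no centre. *)
  have : #|out x| <= 2 + 2 + #|D|.
    rewrite -(cardsID (centres B :|: B)) setDE leq_add ?subset_leq_card ?subsetIr //.
    rewrite setIUr (leq_trans (leq_card_setU _ _)) // leq_add //.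
      rewrite leqNgt; apply/negP => h; move: B2; rewrite ltnNge.
      by rewrite (@no_chain x _ B _ _ h) ?subsetIl ?subsetIr.
    by rewrite eB codeg_centres // -eB.
  (* Two centres joined to x would have out-sets meeting exactly in [B], which misses x. *)
  have : #|inn x| <= 1 + #|B :&: inn x| + #|D|.
    rewrite -(cardsID (centres B :|: B)) setDE leq_add ?subset_leq_card ?subsetIr //.
    rewrite setIUr (leq_trans (leq_card_setU _ _)) // leq_add // 1?setIC //.
    rewrite leqNgt; apply/negP => /card_gt1P[u [v []]].
    rewrite !inE => /andP[uB xu] /andP[vB xv] uv.
    move: xB; rewrite eB (@codeg_unique x1 x2 u v B) -?eB //.
      by rewrite !inE xu xv.
    by rewrite subsetI uB.
  by lia.
(* The three in-sets together miss at most 15 + 6 |D| points of [B], and |B| >= 18 + 6 |D|. *)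
have three : 2 < #|B :&: inn a :&: inn b :&: inn c|.
  have := inn_ge a aD; have := inn_ge b bD; have := inn_ge c cD.
  have capD X Y : #|B :&: X| + #|B :&: Y| <= #|B| + #|B :&: X :&: Y|.
    rewrite -(cardsUI (B :&: X)) setIACA setIid setIA leq_add2r.
    by rewrite -setIUr subset_leq_card ?subsetIl.
  have := capD (inn a) (inn b); have := capD (inn a :&: inn b) (inn c).
  by rewrite !setIA; lia.
(* These common in-neighbours are out-neighbours of [x1], so [no_chain] forbids three distinct
   targets. *)
have /negP := ltnn 2; apply.
apply: leq_trans (@no_chain x1 _ [set a; b; c] _ _ three).
- by rewrite setUC cardsU1 !inE negb_or ca eq_sym bc cards2 ab.
- by rewrite -!setIA (subset_trans (subsetIl _ _)) // eB subsetIl.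
- apply/subsetP => y; rewrite !inE => /andP[/andP[/andP[_ ya] yb] yc].
  by apply/subsetP => z; rewrite !inE => /orP[/orP[]|] /eqP ->.
Qed.

End Digraph.

Local Open Scope ring_scope.

(** * Euclidean geometry of spheres and lines *)

Section Geometry.
Variable R : realType.
Implicit Types (a b c p u v w x y z : 'rV[R]_3) (t rho : R).

Definition i1 : 'I_3 := lift ord0 ord0.
Definition i2 : 'I_3 := lift ord0 (lift ord0 ord0).

Lemma dotE u v :
  dot u v = u ord0 ord0 * v ord0 ord0 + u ord0 i1 * v ord0 i1
            + u ord0 i2 * v ord0 i2.
Proof. by rewrite /dot !big_ord_recl big_ord0 addr0 addrA. Qed.

Lemma row3P u v :
  u ord0 ord0 = v ord0 ord0 -> u ord0 i1 = v ord0 i1 -> u ord0 i2 = v ord0 i2 ->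
  u = v.
Proof.
move=> e0 e1 e2; apply/rowP => -[[|[|[|//]]] k].
- by rewrite (_ : Ordinal k = ord0) //; apply/val_inj.
- by rewrite (_ : Ordinal k = i1) //; apply/val_inj.
- by rewrite (_ : Ordinal k = i2) //; apply/val_inj.
Qed.

Lemma dot_ge0 u : 0 <= dot u u.
Proof. by rewrite dotE !addr_ge0 // -expr2 sqr_ge0. Qed.

Lemma dot_eq0 u : (dot u u == 0) = (u == 0).
Proof.
apply/eqP/eqP => [|->]; last by rewrite dotE !mxE; ring.
rewrite dotE -!expr2 => /eqP; rewrite !paddr_eq0 ?addr_ge0 ?sqr_ge0 // !sqrf_eq0.
by move=> /andP[/andP[/eqP e0 /eqP e1] /eqP e2]; apply: row3P; rewrite ?e0 ?e1 ?e2 mxE.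
Qed.

Lemma dist_eq0 x y : (eucl_dist x y == 0) = (x == y).
Proof.
by rewrite /eucl_dist sqrtr_eq0 le_eqVlt ltNge dot_ge0 orbF dot_eq0 subr_eq0.
Qed.

Lemma dist_gt0 x y : (0 < eucl_dist x y) = (x != y).
Proof. by rewrite lt0r dist_eq0 sqrtr_ge0 andbT. Qed.

Lemma dist_sqr x y : eucl_dist x y ^+ 2 = dot (x - y) (x - y).
Proof. by rewrite sqr_sqrtr ?dot_ge0. Qed.

Lemma distC x y : eucl_dist x y = eucl_dist y x.
Proof. by congr Num.sqrt; rewrite !dotE !mxE; ring. Qed.

Lemma dist_eqE x y x' y' :
  eucl_dist x y = eucl_dist x' y' <-> dot (x - y) (x - y) = dot (x' - y') (x' - y').
Proof.
split=> [e|]; last by rewrite /eucl_dist => ->.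
by rewrite -!dist_sqr e.
Qed.

Definition cross u v : 'rV[R]_3 :=
  \row_j (if j == ord0 then u ord0 i1 * v ord0 i2 - u ord0 i2 * v ord0 i1
          else if j == i1 then u ord0 i2 * v ord0 ord0 - u ord0 ord0 * v ord0 i2
          else u ord0 ord0 * v ord0 i1 - u ord0 i1 * v ord0 ord0).

Definition coordE := (dotE, mxE, eqxx).


(* Two expansions of [cross w (cross a w)]. *)
Lemma cross_expansion a e f (w := cross e f) :
  dot w w *: a =
  dot a w *: w + dot a f *: cross w e - dot a e *: cross w f.
Proof. by apply: row3P; rewrite /w !coordE /=; ring. Qed.

Lemma lagrange_cross u v : cross u v = 0 -> dot u u *: v = dot u v *: u.
Proof.
move=> uv; have : dot u u *: v = dot u v *: u - cross u (cross u v).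
  by apply: row3P; rewrite !coordE /=; ring.
by move=> ->; rewrite uv; apply: row3P; rewrite !coordE /=; ring.
Qed.

Lemma dotC u v : dot u v = dot v u.
Proof. by rewrite !dotE; ring. Qed.

Lemma dotDl u v w : dot (u + v) w = dot u w + dot v w.
Proof. by rewrite !coordE; ring. Qed.

Lemma dotBl u v w : dot (u - v) w = dot u w - dot v w.
Proof. by rewrite !coordE; ring. Qed.

Lemma dotZl t u v : dot (t *: u) v = t * dot u v.
Proof. by rewrite !coordE; ring. Qed.

Lemma dotBr u v w : dot w (u - v) = dot w u - dot w v.
Proof. by rewrite !coordE; ring. Qed.

Lemma dotDr u v w : dot w (u + v) = dot w u + dot w v.
Proof. by rewrite !coordE; ring. Qed.

Lemma dotZr t u v : dot v (t *: u) = t * dot v u.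
Proof. by rewrite !coordE; ring. Qed.

Definition dot_linear := (dotBl, dotDl, dotZl, dotBr, dotDr, dotZr).

Lemma pythagoras t u v : dot v u = 0 ->
  dot (t *: u - v) (t *: u - v) = dot v v + t ^+ 2 * dot u u.
Proof. by move=> vu; rewrite !dot_linear (dotC u v) vu; ring. Qed.

(** The hypotheses say, without division, that a and b are parallel to w. *)
Lemma collinear_cross w a b :
    w != 0 -> dot w w *: a = dot a w *: w -> dot w w *: b = dot b w *: w ->
  cross a b = 0.
Proof.
rewrite -dot_eq0 => w0 ea eb.
suff: dot w w ^+ 2 *: cross a b = 0.
  by move/eqP; rewrite scaler_eq0 expf_eq0 (negbTE w0) /= => /eqP.
transitivity (cross (dot w w *: a) (dot w w *: b)).
  by apply: row3P; rewrite !coordE /=; ring.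
by rewrite ea eb; apply: row3P; rewrite !coordE /=; ring.
Qed.

(** If y3 - y1 = t (y2 - y1), the sphere equations force t^2 = t, so y3 is y1 or y2. *)
Lemma sphere_not_collinear c y1 y2 y3 :
    eucl_dist c y1 = eucl_dist c y2 -> eucl_dist c y1 = eucl_dist c y3 ->
    y1 != y2 -> y2 != y3 -> y3 != y1 ->
  cross (y2 - y1) (y3 - y1) != 0.
Proof.
move=> /dist_eqE d2 /dist_eqE d3 n12 n23 n31; apply/eqP => /lagrange_cross.
set e := y2 - y1; set f := y3 - y1 => ef.
have ee : dot e e = 2 * dot e (c - y1).
  move: d2; rewrite /e !dot_linear (dotC y2 c) (dotC y1 c) (dotC y2 y1).
  by move=> d2; lra.
have ff : dot f f = 2 * dot f (c - y1).
  move: d3; rewrite /f !dot_linear (dotC y3 c) (dotC y1 c) (dotC y3 y1).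
  by move=> d3; lra.
have e0 : dot e e != 0 by rewrite dot_eq0 subr_eq0 eq_sym.
pose t := dot e f / dot e e.
have ft : f = t *: e.
  by apply: (scalerI e0); rewrite ef scalerA mulrCA divff // mulr1.
have : t * (t - 1) * dot e e = 0.
  by move: ff; rewrite ft !(dotZl, dotZr) ee; lra.
move/eqP; rewrite mulf_eq0 (negbTE e0) orbF mulf_eq0 subr_eq0 => /orP[] /eqP t1.
  by move: ft; rewrite t1 scale0r => /eqP; rewrite subr_eq0 (negbTE n31).
by move: ft; rewrite t1 scale1r => /addIr /eqP; rewrite eq_sym (negbTE n23).
Qed.

Lemma perp_of_equidistant x1 x2 y1 y2 :
    eucl_dist x1 y1 = eucl_dist x1 y2 -> eucl_dist x2 y1 = eucl_dist x2 y2 ->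
  dot (x2 - x1) (y2 - y1) = 0.
Proof.
move=> /dist_eqE d1 /dist_eqE d2; move: d1 d2.
rewrite !dot_linear (dotC y1 x1) (dotC y2 x1) (dotC y1 x2) (dotC y2 x2) => d1 d2.
by lra.
Qed.

(** The vector x2 - x1 is orthogonal to two sides of the triangle, so only its component along the
    normal [w] survives in [cross_expansion]. *)
Lemma centres_on_axis x1 x2 y1 y2 y3 (w := cross (y2 - y1) (y3 - y1)) :
    eucl_dist x1 y1 = eucl_dist x1 y2 -> eucl_dist x1 y1 = eucl_dist x1 y3 ->
    eucl_dist x2 y1 = eucl_dist x2 y2 -> eucl_dist x2 y1 = eucl_dist x2 y3 ->
  dot w w *: (x2 - x1) = dot (x2 - x1) w *: w.
Proof.
move=> d12 d13 d22 d23; rewrite cross_expansion.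
by rewrite !perp_of_equidistant // !scale0r addr0 subr0.
Qed.

Lemma axis_line x1 x2 x3 y1 y2 y3 :
    x1 != x2 -> y1 != y2 -> y2 != y3 -> y3 != y1 ->
    eucl_dist x1 y1 = eucl_dist x1 y2 -> eucl_dist x1 y1 = eucl_dist x1 y3 ->
    eucl_dist x2 y1 = eucl_dist x2 y2 -> eucl_dist x2 y1 = eucl_dist x2 y3 ->
    eucl_dist x3 y1 = eucl_dist x3 y2 -> eucl_dist x3 y1 = eucl_dist x3 y3 ->
  exists t, x3 = x1 + t *: (x2 - x1).
Proof.
move=> x12 n12 n23 n31 d12 d13 d22 d23 d32 d33.
have w0 := sphere_not_collinear d12 d13 n12 n23 n31.
have c2 := centres_on_axis d12 d13 d22 d23.
have c3 := centres_on_axis d12 d13 d32 d33.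
have /lagrange_cross e := collinear_cross w0 c2 c3.
have u0 : dot (x2 - x1) (x2 - x1) != 0 by rewrite dot_eq0 subr_eq0 eq_sym.
exists (dot (x2 - x1) (x3 - x1) / dot (x2 - x1) (x2 - x1)).
apply/eqP; rewrite addrC -subr_eq; apply/eqP/(scalerI u0).
by rewrite e scalerA mulrCA divff // mulr1.
Qed.

(** The difference of the squared distances to y and y' is affine in the point and vanishes at x1
    and x2. *)
Lemma equidistant_on_line x1 x2 y y' t :
    eucl_dist x1 y = eucl_dist x1 y' -> eucl_dist x2 y = eucl_dist x2 y' ->
  eucl_dist (x1 + t *: (x2 - x1)) y = eucl_dist (x1 + t *: (x2 - x1)) y'.
Proof.
move=> d1 d2; have := perp_of_equidistant d1 d2; move/dist_eqE: d1 => d1 p.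
apply/dist_eqE; move: d1 p.
rewrite !dot_linear (dotC y x1) (dotC y' x1) (dotC y x2) (dotC y' x2).
set a := dot x1 y; set a' := dot x1 y'; set b := dot x2 y; set b' := dot x2 y'.
move=> d1 p; have -> : b' = b - a + a' by lra.
have -> : dot y' y' = dot y y - 2 * a + 2 * a' by lra.
ring.
Qed.

(* Centres equidistant from three points lie on a line, which a sphere meets
   at most twice. *)
Lemma no_three_three x y1 y2 y3 z1 z2 z3 :
    y1 != y2 -> y2 != y3 -> y3 != y1 -> z1 != z2 -> z2 != z3 -> z3 != z1 ->
    eucl_dist x y1 = eucl_dist x y2 -> eucl_dist x y1 = eucl_dist x y3 ->
    eucl_dist y1 z1 = eucl_dist y1 z2 -> eucl_dist y1 z1 = eucl_dist y1 z3 ->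
    eucl_dist y2 z1 = eucl_dist y2 z2 -> eucl_dist y2 z1 = eucl_dist y2 z3 ->
    eucl_dist y3 z1 = eucl_dist y3 z2 -> eucl_dist y3 z1 = eucl_dist y3 z3 ->
  False.
Proof.
move=> y12 y23 y31 z12 z23 z31 x2 x3 d12 d13 d22 d23 d32 d33.
have /eqP := sphere_not_collinear x2 x3 y12 y23 y31; apply.
by apply: collinear_cross (sphere_not_collinear d12 d13 z12 z23 z31) _ _;
  apply: centres_on_axis.
Qed.
End Geometry.

(** * A balanced suspension with about n^2/4 edges *)

Section LowerBound.
Variable R : realType.

Definition axis_pt (i : nat) : 'rV[R]_3 := \row_j (if j == i2 then i%:R else 0).
(** Points of the unit circle whose first coordinates 1/(i+1) are distinct, and nonzero to stay off
    the axis. *)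
Definition circle_pt (i : nat) : 'rV[R]_3 :=
  \row_j (if j == ord0 then i.+1%:R^-1
          else if j == i1 then Num.sqrt (1 - i.+1%:R^-1 ^+ 2) else 0).

Lemma axis_pt_inj : injective axis_pt.
Proof.
by move=> i j /rowP/(_ i2); rewrite !mxE eqxx => /eqP; rewrite eqr_nat => /eqP.
Qed.

Lemma circle_pt_inj : injective circle_pt.
Proof.
by move=> i j /rowP/(_ ord0); rewrite !mxE eqxx => /invr_inj/eqP; rewrite eqr_nat => /eqP[].
Qed.

Lemma axis_neq_circle i j : axis_pt i != circle_pt j.
Proof.
apply/eqP => /rowP/(_ ord0); rewrite !mxE /= => /eqP.
by rewrite eq_sym invr_eq0 pnatr_eq0.
Qed.

Lemma dist_axis_circle i j :
  eucl_dist (axis_pt i) (circle_pt j) = Num.sqrt (1 + (axis_pt i) ord0 i2 ^+ 2).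
Proof.
congr Num.sqrt; rewrite !coordE /= !sub0r !subr0 !mulrNN -!expr2 sqr_sqrtr.
  by ring.
by rewrite subr_ge0 exprVn invf_le1 ?exprn_gt0 ?ltr0n // exprn_ege1 // ler1n.
Qed.

(** The edges from axis to circle number floor(n/2) ceil(n/2), which is (n^2 - 1)/4 for odd n; hence
    the + 1. *)
Lemma f3_lower n : (n ^ 2 <= 4 * f3 R n + 1)%N.
Proof.
pose s := map axis_pt (iota 0 n./2) ++ map circle_pt (iota 0 (uphalf n)).
have s_uniq : uniq s.
  rewrite cat_uniq (map_inj_uniq axis_pt_inj) (map_inj_uniq circle_pt_inj).
  rewrite !iota_uniq andbT /=; apply/hasPn => _ /mapP[j _ ->].
  by apply/mapP => -[i _ e]; have := axis_neq_circle i j; rewrite e eqxx.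
pose S : {fset 'rV[R]_3} := [fset x in s]%fset.
pose r (x : 'rV[R]_3) := Num.sqrt (1 + x ord0 i2 ^+ 2).
have S_card : #|` S| = n.
  rewrite card_fseq undup_id // size_cat !size_map !size_iota.
  by rewrite uphalf_half addnCA addnn odd_double_half.
have r_gt0 : radius_fun S r.
  by move=> x _; rewrite sqrtr_gt0 ltr_wpDr ?sqr_ge0.
have : (nb_edges r S <= f3 R n)%N by apply: f3_ge; exists S, r.
have : (n./2 * uphalf n <= nb_edges r S)%N.
  rewrite -{1}(size_iota 0 n./2) -(size_iota 0 (uphalf n)).
  rewrite -(size_allpairs (fun i j => (axis_pt i, circle_pt j))).
  apply: uniq_leq_size.
    apply: allpairs_uniq; rewrite ?iota_uniq // => -[i j] [i' j'] _ _ /=.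
    by case=> /axis_pt_inj -> /circle_pt_inj ->.
  move=> _ /allpairsP[[i j] /= [ii jj ->]].
  rewrite !inE /= dist_axis_circle eqxx andbT.
  by rewrite (map_f axis_pt ii) (map_f circle_pt jj) orbT.
have := odd_double_half n; rewrite uphalf_half.
by move: (f3 R n) (nb_edges r S) => f e; case: (odd n); nia.
Qed.

End LowerBound.

(** * The digraph of a point set with radii *)

Section FavouriteDigraph.
Variables (R : realType) (S : {fset 'rV[R]_3}) (r : 'rV[R]_3 -> R).
Implicit Types (x y : S) (B : {set S}).

Definition favourite : rel S := fun x y => eucl_dist (val x) (val y) == r (val x).
Local Notation out := (out favourite).
Local Notation inn := (inn favourite).
Local Notation centres := (centres favourite).

Lemma favourite_eq x y y' : y \in out x -> y' \in out x ->
  eucl_dist (val x) (val y) = eucl_dist (val x) (val y').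
Proof. by rewrite !inE => /eqP -> /eqP ->. Qed.

Lemma favourite_irr x : radius_fun S r -> ~~ favourite x x.
Proof.
move=> /(_ _ (valP x)) rx; apply/eqP => e; move: rx.
by rewrite -e dist_gt0 eqxx.
Qed.

Lemma common_out_line x1 x2 x3 : x1 != x2 ->
    (2 < #|out x1 :&: out x2 :&: out x3|)%N ->
  exists t, val x3 = val x1 + t *: (val x2 - val x1).
Proof.
move=> x12 /card_gt2P[y1 [y2 [y3 [[h1 h2 h3] [n12 n23 n31]]]]].
move: h1 h2 h3; rewrite !(in_setI _ (_ :&: _)) !(in_setI _ (out x1)).
move=> /andP[/andP[h11 h12] h13] /andP[/andP[h21 h22] h23] /andP[/andP[h31 h32] h33].
by apply: (@axis_line _ _ _ _ (val y1) (val y2) (val y3)) => //; exact: favourite_eq.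
Qed.

(** The point [x3] is on the line x1 x2, hence equidistant from all common out-neighbours of [x1]
    and [x2]; one of them fixes its radius. *)
Lemma favourite_codeg x1 x2 x3 : x1 != x2 ->
  (2 < #|out x1 :&: out x2 :&: out x3|)%N -> out x1 :&: out x2 \subset out x3.
Proof.
move=> x12 h; have [t e] := common_out_line x12 h.
have /card_gt0P[y] : (0 < #|out x1 :&: out x2 :&: out x3|)%N by apply: leq_trans h.
rewrite !in_setI => /andP[/andP[y1 y2] y3]; apply/subsetP => z.
rewrite in_setI => /andP[z1 z2]; move: y3; rewrite !inE /favourite => /eqP <-.
by rewrite e; apply/eqP/equidistant_on_line; exact: favourite_eq.
Qed.

Lemma favourite_no_chain x (Y Z : {set S}) :
  Y \subset out x -> Y \subset centres Z -> (2 < #|Y|)%N -> (#|Z| <= 2)%N.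
Proof.
move=> Yx YZ /card_gt2P[y1 [y2 [y3 [[h1 h2 h3] [n12 n23 n31]]]]].
rewrite leqNgt; apply/negP => /card_gt2P[z1 [z2 [z3 [[k1 k2 k3] [m12 m23 m31]]]]].
have YZd y z z' : y \in Y -> z \in Z -> z' \in Z ->
    eucl_dist (val y) (val z) = eucl_dist (val y) (val z').
  move=> /(subsetP YZ); rewrite inE => /subsetP yZ zZ zZ'.
  by apply: favourite_eq; apply: yZ.
apply: (@no_three_three _ (val x) (val y1) (val y2) (val y3) (val z1) (val z2) (val z3)) => //;
  by [apply: favourite_eq; apply: (subsetP Yx)|apply: YZd].
Qed.

Lemma card_fset_image_le (K : choiceType) (X : finType) (A : {fset K})
    (P : {set X}) (f : X -> K) :
  {subset A <= [seq f p | p in P]} -> (#|` A| <= #|P|)%N.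
Proof. by move=> sAP; rewrite -(size_image f); apply: uniq_leq_size. Qed.

Lemma nb_edges_le_sum : (nb_edges r S <= \sum_x #|out x|)%N.
Proof.
have -> : (\sum_x #|out x| = #|[set p : S * S | favourite p.1 p.2]|)%N.
  rewrite -sum1_card (eq_bigl (fun p => favourite p.1 p.2)); last by move=> p; rewrite inE.
  rewrite -(pair_big_dep predT favourite (fun _ _ => 1%N)) /=.
  by apply: eq_bigr => x _; rewrite -sum1_card; apply: eq_bigl => y; rewrite inE.
apply: (@card_fset_image_le _ _ _ _ (fun p => (val p.1, val p.2))) => -[u v].
rewrite !inE /= => /andP[/andP[uS vS] uv].
by apply/imageP; exists ([` uS]%fset, [` vS]%fset); rewrite ?inE.
Qed.

Lemma nb_edges_delete x :
  (nb_edges r S <= nb_edges r (S `\ val x)%fset + (#|out x| + #|inn x|))%N.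
Proof.
pose A2 := [fset p in edges r S | p.1 == val x]%fset.
pose A3 := [fset p in edges r S | p.2 == val x]%fset.
have sub : (edges r S `<=` edges r (S `\ val x) `|` (A2 `|` A3))%fset.
  apply/fsubsetP => -[u v]; rewrite !inE /= => /andP[/andP[uS vS] ->].
  by rewrite uS vS; case: eqP; case: eqP.
apply: leq_trans (fsubset_leq_card sub) _.
have leU (X Y : {fset 'rV[R]_3 * 'rV[R]_3}) : (#|` X `|` Y|%fset <= #|` X| + #|` Y|)%N.
  by rewrite cardfsU leq_subr.
apply: leq_trans (leU _ _) _; rewrite leq_add2l.
apply: leq_trans (leU _ _) _; apply: leq_add.
  apply: (@card_fset_image_le _ _ _ _ (fun y => (val x, val y))) => -[u v].
  rewrite !inE /= => /andP[/andP[/andP[uS vS] uv] /eqP eu]; subst u.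
  by apply/imageP; exists [` vS]%fset; rewrite ?inE.
apply: (@card_fset_image_le _ _ _ _ (fun y => (val y, val x))) => -[u v].
rewrite !inE /= => /andP[/andP[/andP[uS vS] uv] /eqP ev]; subst v.
by apply/imageP; exists [` uS]%fset; rewrite ?inE.
Qed.

Lemma fresh_on_line (a b : 'rV[R]_3) : a != b ->
  exists t, a + t *: (b - a) \notin S.
Proof.
move=> ab; pose p (k : nat) := a + k%:R *: (b - a).
have p_inj : injective p.
  move=> i j /addrI /eqP; rewrite -subr_eq0 -scalerBl scaler_eq0 !subr_eq0.
  by rewrite [b == a]eq_sym (negbTE ab) orbF eqr_nat => /eqP.
have [/allP h|] := boolP (all [in S] (map p (iota 0 #|` S|.+1))).
  have := uniq_leq_size _ h; rewrite size_map size_iota ltnn.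
  by rewrite map_inj_uniq ?iota_uniq // => /(_ isT).
by case/allPn => _ /mapP[k _ ->] pS; exists k%:R.
Qed.

(* Replace [x] by a fresh point of the axis at its distance to the circle. *)
Lemma degree_ge x1 x2 x (B := out x1 :&: out x2) :
    radius_fun S r -> nb_edges r S = f3 R #|` S| ->
    x1 != x2 -> (2 < #|B|)%N -> x \notin B ->
  (#|B| <= #|out x| + #|inn x|)%N.
Proof.
move=> r_gt0 r_max x12 B2 xB.
have [t pS] := @fresh_on_line (val x1) (val x2) x12.
set p := _ + _ in pS.
have /card_gt0P[y0 y0B] : (0 < #|B|)%N by apply: leq_trans B2.
have p_eq y : y \in B -> eucl_dist p (val y) = eucl_dist p (val y0).
  move: y0B; rewrite !in_setI => /andP[y01 y02] /andP[y1 y2].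
  by apply: equidistant_on_line; exact: favourite_eq.
pose r' q := if q == p then eucl_dist p (val y0) else r q.
pose S' := (p |` (S `\ val x))%fset.
have S'_card : #|` S'| = #|` S|.
  by rewrite cardfsU1 !inE (negbTE pS) andbF (cardfsD1 (val x) S) (valP x).
have r'_gt0 : radius_fun S' r'.
  move=> q; rewrite !inE /r'; case: eqP => [_ _|_ /= /andP[_ /r_gt0] //].
  by rewrite dist_gt0; apply: contraNneq pS => ->; exact: valP.
have le_max : (nb_edges r' S' <= nb_edges r S)%N.
  by rewrite r_max -S'_card; apply: f3_ge; exists S', r'.
(* Edges avoiding x keep their radii as [p] is not in S, and all of [B] survives the deletion, so
   [p] adds |B| edges. *)
have ge_new : (nb_edges r (S `\ val x)%fset + #|B| <= nb_edges r' S')%N.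
  rewrite -(size_image (fun y => (p, val y))) -size_cat; apply: uniq_leq_size.
    rewrite cat_uniq fset_uniq map_inj_uniq ?enum_uniq; last by move=> y y' [] /val_inj.
    rewrite andbT; apply/hasPn => _ /imageP[y _ ->].
    by rewrite !inE /= (negbTE pS) !andbF.
  move=> [u v]; rewrite mem_cat => /orP[|/imageP[y yB [-> ->]]].
    rewrite !inE /= => /andP[/andP[/andP[-> uS] /andP[-> vS]] uv].
    rewrite uS vS !orbT /= /r'; case: (u =P p) uS => // ->.
    by rewrite (negbTE pS).
  rewrite !inE /= eqxx /r' eqxx p_eq // eqxx (valP y) andbT /= andbT.
  apply/orP; right; apply: contraNneq xB => /val_inj e.
  by rewrite -e.
have := nb_edges_delete x; lia.
Qed.

Lemma suspension_of_common_out x1 x2 (B := out x1 :&: out x2) :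
    x1 != x2 -> (2 < #|B|)%N ->
  exists C L : set 'rV[R]_3,
    [/\ circle_with_axis C L,
        forall x, x \in centres B :|: B -> (C `|` L)%classic (val x) &
        forall x, x \in centres B :|: B -> L (val x) ->
          r (val x) = eucl_dist_set (val x) C].
Proof.
move=> x12 B2.
have [y1 [y2 [y3 [[h1 h2 _] [n12 _ _]]]]] := card_gt2P B2.
pose u := val x2 - val x1.
have u0 : dot u u != 0 by rewrite dot_eq0 subr_eq0 eq_sym.
(* The centre [c] is the foot of the perpendicular from [y1] to the line x1 x2. *)
pose t := dot (val y1 - val x1) u / dot u u.
pose c := val x1 + t *: u.
have c_dist y : y \in B -> eucl_dist c (val y) = eucl_dist c (val y1).
  move: h1; rewrite !in_setI => /andP[? ?] /andP[? ?].
  by apply: equidistant_on_line; exact: favourite_eq.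
have c_perp y : y \in B -> dot (val y - c) u = 0.
  move=> yB; have e1 : dot (val y1 - c) u = 0.
    by rewrite /c opprD addrA dotBl dotZl divfK // subrr.
  rewrite -(subrK (val y1) (val y)) -addrA dotDl e1 addr0 dotC.
  move: h1 yB; rewrite !in_setI => /andP[? ?] /andP[? ?].
  by apply: perp_of_equidistant; exact: favourite_eq.
pose rho := eucl_dist c (val y1).
have rho_gt0 : 0 < rho.
  rewrite dist_gt0; apply: contraNneq n12 => e.
  by rewrite -val_eqE /= -dist_eq0 -e c_dist // -e dist_eq0.
pose C := circle c u rho; pose L := line c u.
have BC y : y \in B -> C (val y) by move=> yB; split; rewrite ?c_perp // distC c_dist.
have AL x : x \in centres B -> L (val x).
  rewrite inE => Bx; have [|s ->] := @common_out_line x1 x2 x x12.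
    by rewrite (setIidPl Bx).
  by exists (s - t); rewrite /c -addrA -scalerDl [t + _]addrC subrK.
(* As circle and axis are disjoint, the radius condition concerns only centres of [B]. *)
have CL z : C z -> L z -> False.
  move=> [zu zr] [s e]; move: zu zr; rewrite e addrC addKr dotZl => /eqP.
  rewrite mulf_eq0 (negbTE u0) orbF => /eqP -> zr.
  by move: rho_gt0; rewrite -zr scale0r addr0 dist_gt0 eqxx.
(* An axis point is equidistant from the whole circle, so the infimum below is over a singleton. *)
have L_dist (z y : 'rV[R]_3) : L z -> C y -> eucl_dist z y = eucl_dist z (val y1).
  move=> [s ->] Cy; have Cy1 := BC _ h1; apply/dist_eqE.
  have sq w : C w -> dot (c + s *: u - w) (c + s *: u - w) = rho ^+ 2 + s ^+ 2 * dot u u.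
    move=> [wu wr]; have -> : c + s *: u - w = s *: u - (w - c).
      by rewrite opprB addrAC addrC.
    by rewrite -wr dist_sqr pythagoras.
  by rewrite !sq.
exists C, L; split.
- by exists c, u, rho; split=> //; rewrite -dot_eq0.
- move=> x; rewrite in_setU => /orP[xA|xB]; [right|left].
    exact: AL.
  exact: BC.
- move=> x; rewrite in_setU => /orP[xA|xB] Lx; last first.
    by case: (CL _ (BC _ xB) Lx).
  rewrite /eucl_dist_set (_ : [set _ | _ in _]%classic = [set eucl_dist (val x) (val y1)]%classic).
    rewrite inf1; move: xA; rewrite inE => /subsetP/(_ _ h1).
    by rewrite inE => /eqP.
  apply/seteqP; split => [_ [y Cy <-]|_ ->]; first exact: L_dist.
  by exists (val y1) => //; exact: BC.
Qed.

End FavouriteDigraph.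

Theorem theorem2 (R : realType) :
  exists n0 : nat,
    forall (S : {fset 'rV[R]_3}) (r : 'rV[R]_3 -> R),
      (n0 <= #|` S|)%N ->
      radius_fun S r ->
      nb_edges r S = f3 R #|` S| ->
      exists T : {fset 'rV[R]_3},
        [/\ (T `<=` S)%fset, (#|` T| <= 2)%N &
            exists C L : set 'rV[R]_3, suspension (S `\` T)%fset r C L].
Proof.
(* Sets of at least n/q points are rich; [q] stays abstract so that [1608 * q ^ 2] is never
   evaluated. *)
have [q q_big] : exists q, (400 * 200 <= q)%N by exists (400 * 200)%N.
exists (1608 * q ^ 2)%N => S r S_big r_gt0 r_max.
have n_big : (1608 * q ^ 2 <= #|{: S}|)%N by rewrite -cardfE.
have e_big : (#|{: S}| ^ 2 <= 4 * (\sum_(x : S) #|out (favourite r) x|) + 1)%N.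
  rewrite -cardfE; apply: leq_trans (f3_lower R _) _.
  by rewrite -r_max leq_add2r leq_mul2l nb_edges_le_sum.
have [x1 [x2 [x12 B2 D2]]] := suspension_structure
  (fun x => favourite_irr x r_gt0) (@favourite_codeg _ S r)
  (@favourite_no_chain _ S r) (fun x1 x2 x => degree_ge r_gt0 r_max)
  q_big n_big e_big.
set B := out _ x1 :&: out _ x2 in B2 D2; set D := ~: _ in D2.
exists [fset val x | x in D]%fset; split.
- by apply/fsubsetP => _ /imfsetP[x _ ->]; exact: valP.
- rewrite card_imfset; last exact: val_inj.
  by rewrite -cardE.
have [C [L [CL SL rL]]] := suspension_of_common_out x12 B2.
have sub z : z \in (S `\` [fset val x | x in D])%fset ->
    exists2 x : S, x \in centres (favourite r) B :|: B & z = val x.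
  rewrite inE => /andP[zD zS]; exists [` zS]%fset => //.
  by apply: contraNT zD => zAB; apply/imfsetP; exists [` zS]%fset => //=; rewrite inE.
exists C, L; split=> //.
  by move=> z /sub[x xAB ->]; exact: SL.
by move=> z /sub[x xAB ->]; exact: rL.
Qed.
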